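(* Let $a\in(0,1)$ and $p\in[1,\infty)$. Then the $L_p$-discrepancy anchored at $a$ suffers from the curse of dimensionality, i.e., the quantity $$N_{L_p^{\pitchfork,(a)}}(\varepsilon,d):=\min\{N\in\mathbb{N}:\ \exists\,\mathcal{P}\subseteq[0,1)^d\text{ such that }|\mathcal{P}|=N\text{ and }L_p^{\pitchfork,(a)}(\mathcal{P})\le\varepsilon\,L_p^{\pitchfork,(a)}(\emptyset)\}$$ grows exponentially fast with the dimension $d$. In more detail, $$N_{L_p^{\pitchfork,(a)}}(\varepsilon,d)\ge C_{p,1}^d\,(1-\varepsilon)\quad\text{for all }\varepsilon\in(0,1)\text{ and }d\in\mathbb{N},$$ where $$C_{p,1}=1+\left(\frac{1}{\max(a,1-a)}-1\right)^{p+1}>1.$$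
   Context: For a point set $\mathcal{P}=\{\boldsymbol{y}_1,\ldots,\boldsymbol{y}_N\}$ in $[0,1)^d$, the $L_p$-discrepancy anchored at $a$ is $$L_p^{\pitchfork,(a)}(\mathcal{P})=\left(\int_{[0,1]^d}\left|\frac1N\sum_{k=1}^N\mathbf{1}_{J(\boldsymbol{t})}(\boldsymbol{y}_k)-\mathrm{Vol}(J(\boldsymbol{t}))\right|^p\mathrm{d}\boldsymbol{t}\right)^{1/p},$$ where for $\boldsymbol{t}=(t_1,\dots,t_d)\in[0,1]^d$ the test set is $J(\boldsymbol{t})=J(t_1)\times\cdots\times J(t_d)$ with $J(t)=[\min(t,a),\max(t,a))$, $\mathbf{1}$ denotes the indicator function and $\mathrm{Vol}$ the volume. The initial discrepancy (counting term omitted) is $$L_p^{\pitchfork,(a)}(\emptyset)=\left(\int_{[0,1]^d}\mathrm{Vol}(J(\boldsymbol{t}))^p\,\mathrm{d}\boldsymbol{t}\right)^{1/p}=\left(\frac{a^{p+1}+(1-a)^{p+1}}{p+1}\right)^{d/p}.$$ $\mathbb{N}=\{1,2,\dots\}$; the minimum of the empty set is $\infty$. *)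

(* Defs.v *)
From HB Require Import structures.
From mathcomp Require Import all_boot all_order all_algebra finmap.
From mathcomp Require Import all_classical all_reals all_analysis.

Set Implicit Arguments.
Unset Strict Implicit.
Unset Printing Implicit Defensive.

Import Order.TTheory GRing.Theory Num.Theory.
Import numFieldNormedType.Exports.

Local Open Scope classical_set_scope.
Local Open Scope ring_scope.

Section lebesgue_tuple.
Variable R : realType.
Local Notation RT := (measurableTypeR R).

Definition uncurry_cons (n : nat) (x : RT * n.-tuple RT) : n.+1.-tuple RT :=
  [tuple of x.1 :: x.2].

Definition uncons (n : nat) (t : n.+1.-tuple RT) : RT * n.-tuple RT :=
  (thead t, [tuple of behead t]).

Lemma uncurry_consK n : cancel (@uncurry_cons n) (@uncons n).
Proof. by case=> x t; congr pair; apply/val_inj. Qed.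

Lemma measurable_uncurry_cons n : measurable_fun setT (@uncurry_cons n).
Proof. exact: measurable_cons. Qed.

Lemma measurable_uncons n : measurable_fun setT (@uncons n).
Proof.
apply: measurable_fun_pair; first exact: measurable_tnth.
exact: measurable_behead.
Qed.

Section cons_measure.
Variables (n : nat) (mu : {sigma_finite_measure set (n.-tuple RT) -> \bar R}).

Definition cons_measure : set (n.+1.-tuple RT) -> \bar R :=
  pushforward (lebesgue_measure \x mu)%E (@uncurry_cons n).

Let cons_measure0 : cons_measure set0 = 0%E.
Proof. by rewrite /cons_measure /pushforward preimage_set0 measure0. Qed.

Let cons_measure_ge0 A : (0 <= cons_measure A)%E.
Proof. exact: integral_ge0. Qed.

Let cons_measure_sigma_additive : semi_sigma_additive cons_measure.
Proof.
have mcons A : measurable A -> measurable (@uncurry_cons n @^-1` A).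
  by move=> mA; rewrite -[X in measurable X]setTI; exact: measurable_uncurry_cons.
move=> F mF tF mUF; rewrite /cons_measure /pushforward preimage_bigcup.
apply: measure_semi_sigma_additive.
- by move=> k; exact: mcons.
- apply/trivIsetP => i j _ _ ij; rewrite -preimage_setI.
  by move/trivIsetP : tF => /(_ _ _ _ _ ij) ->//; rewrite preimage_set0.
- by rewrite -preimage_bigcup; exact: mcons.
Qed.

HB.instance Definition _ := isMeasure.Build _ _ _ cons_measure
  cons_measure0 cons_measure_ge0 cons_measure_sigma_additive.

Let cons_measure_sigma_finite : sigma_finite setT cons_measure.
Proof.
have /sigma_finiteP[F [FT ndF Foo]] :=
  sigma_finiteT (@lebesgue_measure R : {sigma_finite_measure set RT -> \bar R}).
have /sigma_finiteP[G [GT ndG Goo]] := sigma_finiteT mu.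
exists (fun k => @uncons n @^-1` (F k `*` G k)).
  apply/esym/seteqP; split=> // t _.
  have [j _ Fj] : (\bigcup_i F i) (uncons t).1 by rewrite -FT.
  have [k _ Gk] : (\bigcup_i G i) (uncons t).2 by rewrite -GT.
  exists (maxn j k) => //; split.
    by move: Fj; apply: subsetPset; exact/ndF/leq_maxl.
  by move: Gk; apply: subsetPset; exact/ndG/leq_maxr.
move=> k; have [mF Fk] := Foo k; have [mG Gk] := Goo k; split.
  rewrite -[X in measurable X]setTI; apply: measurable_uncons => //.
  exact: measurableX.
rewrite /cons_measure /pushforward -comp_preimage.
rewrite (_ : @uncons n \o _ = id); last exact/funext/uncurry_consK.
by rewrite preimage_id product_measure1E// lte_mul_pinfty// ge0_fin_numE.
Qed.

HB.instance Definition _ := Measure_isSigmaFinite.Build _ _ _ cons_measure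
  cons_measure_sigma_finite.

End cons_measure.

(* Lebesgue measure on R^n, as the n-fold product of the Lebesgue measure on R;
   R^0 is a single point of mass 1. *)
Fixpoint lebesgue_tuple (n : nat) :
    {sigma_finite_measure set (n.-tuple RT) -> \bar R} :=
  match n with
  | 0 => @dirac _ (0.-tuple RT) [tuple] R
  | k.+1 => cons_measure (lebesgue_tuple k)
  end.

Lemma lebesgue_tuple_box n (A : 'I_n -> set RT) :
  (forall i, measurable (A i)) ->
  lebesgue_tuple n [set t | forall i, A i (tnth t i)] =
  (\prod_(i < n) lebesgue_measure (A i))%E.
Proof.
elim: n A => [|n IH] A mA.
  by rewrite big_ord0 /= diracE mem_set// => -[].
rewrite big_ord_recl -IH; last by move=> i; exact: mA.
rewrite -product_measure1E//=; last first.
  rewrite (_ : [set t | _] =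
      \bigcap_(i in [set: 'I_n]) (@tnth n RT ^~ i @^-1` A (lift ord0 i))).
    apply: fin_bigcap_measurable => // i _.
    by rewrite -[X in measurable X]setTI; exact: measurable_tnth.
  by apply/seteqP; split => t /= h i => [_|]; exact: h.
congr ((lebesgue_measure \x lebesgue_tuple n)%E _).
apply/seteqP; split => -[x t] /=.
  move=> h; split; first exact: (h ord0).
  by move=> i; have := h (lift ord0 i); rewrite tnthS.
move=> [Ax At] i; case: (unliftP ord0 i) => [j|] -> //.
by rewrite tnthS; exact: At.
Qed.

End lebesgue_tuple.

Section anchored_discrepancy.
Context {R : realType}.
Implicit Types (a p eps : R) (d : nat).

Definition closed_cube d : set (d.-tuple R) :=
  [set t | forall i, 0 <= tnth t i <= 1].

Arguments closed_cube d : clear implicits.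

Definition halfopen_cube d : set (d.-tuple R) :=
  [set t | forall i, 0 <= tnth t i < 1].

Arguments halfopen_cube d : clear implicits.

Definition anchored_box a d (t : d.-tuple R) : set (d.-tuple R) :=
  [set y | forall i, Num.min (tnth t i) a <= tnth y i < Num.max (tnth t i) a].

Definition vol d (A : set (d.-tuple R)) : R := fine (lebesgue_tuple R d A).

Definition disc_fun a d (P : {fset d.-tuple R}) (t : d.-tuple R) : R :=
  (#|` P|%:R)^-1 * (\sum_(y <- P) \1_(anchored_box a t) y)
  - vol (anchored_box a t).

Definition Lp_disc a p d (P : {fset d.-tuple R}) : \bar R :=
  ((\int[lebesgue_tuple R d]_(t in closed_cube d)
      (`|disc_fun a P t| `^ p)%:E) `^ p^-1)%E.

Definition Lp_disc_init a p d : \bar R :=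
  ((\int[lebesgue_tuple R d]_(t in closed_cube d)
      (vol (anchored_box a t) `^ p)%:E) `^ p^-1)%E.

Definition min_nat (S : set nat) : \bar R :=
  match pselect (exists n, n \in S) with
  | left exS => (ex_minn exS)%:R%:E
  | right _ => +oo%E
  end.

Definition Nmin a p eps d : \bar R :=
  min_nat [set N | (0 < N)%N /\
    exists P : {fset d.-tuple R},
      [/\ [set` P] `<=` halfopen_cube d,
          #|` P| = N
        & (Lp_disc a p P <= eps%:E * Lp_disc_init a p d)%E] ].

(* Exponential growth in d, with constants uniform over all small eps. *)
Definition curse_of_dimensionality (N : R -> nat -> \bar R) : Prop :=
  exists c tau eps0 : R, [/\ 0 < c, 0 < tau, 0 < eps0 &
    forall eps d, 0 < eps <= eps0 -> (0 < d)%N ->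
      ((c * (1 + tau) ^+ d)%:E <= N eps d)%E].

Definition Cp1 a p : R := 1 + ((Num.max a (1 - a))^-1 - 1) `^ (p + 1).

End anchored_discrepancy.

(* Main.v *)
(* The value a cuts the cube into 2^d boxes, and the test box J(t) contains only
   points from the box of t. Hence on every box without points of P the
   discrepancy function is -Vol(J(t)), so that
     L_p(empty)^p <= L_p(P)^p + N * M^d,
   where M^d, M = max(a, 1 - a)^(p+1) / (p + 1), is the largest integral of
   Vol(J(t))^p over a single box. As L_p(empty)^p = (C_{p,1} M)^d, the bound on N
   follows by dividing by M^d and using eps^p <= eps. *)
Require Import Defs.
From HB Require Import structures.
From mathcomp Require Import all_boot all_order all_algebra finmap.
From mathcomp Require Import all_classical all_reals all_analysis.
From mathcomp Require Import measurable_realfun lra.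

Set Implicit Arguments.
Unset Strict Implicit.
Unset Printing Implicit Defensive.

Import Order.TTheory GRing.Theory Num.Theory.
Import numFieldNormedType.Exports.

Local Open Scope classical_set_scope.
Local Open Scope ring_scope.

(** * One-dimensional integrals of |x - a|^p on either side of a *)

Lemma continuous_norm_powR (R : realType) (p : R) :
  0 < p -> continuous (fun x : R => `|x| `^ p).
Proof.
move=> p0 x; have [->|x0] := eqVneq x 0.
  rewrite /continuous_at normr0 powR0 ?gt_eqF//; apply/cvgr0Pnorm_lt => e e0.
  (* At 0 differentiability may fail, so continuity is checked directly, with radius e^(1/p); away
     from 0 it follows from differentiability of the power. *)
  have ep : 0 < e `^ p^-1 by exact: powR_gt0.
  near=> y; rewrite ger0_norm ?powR_ge0//.
  have -> : e = (e `^ p^-1) `^ p by rewrite -powRrM mulVf ?gt_eqF// powRr1 ?ltW.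
  apply: gt0_ltr_powR; rewrite ?nnegrE ?powR_ge0//.
apply: (@continuous_comp _ _ _ (fun x : R => `|x|) (@powR R ^~ p)).
  exact: norm_continuous.
apply: differentiable_continuous; apply/derivable1_diffP/derivable_powR.
by rewrite in_itv/= andbT normr_gt0.
Unshelve. all: end_near. Qed.

Lemma continuous_dist_powR (R : realType) (a p : R) :
  0 < p -> continuous (fun x : R => `|x - a| `^ p).
Proof.
move=> p0 x.
apply: (@continuous_comp _ _ _ (fun x => x - a) (fun x => `|x| `^ p)).
  by apply: cvgB; [exact: cvg_id|exact: cvg_cst].
exact: continuous_norm_powR.
Qed.

Lemma integral_dist_powR_right (R : realType) (p a b : R) : 0 < p -> a < b ->
  (\int[lebesgue_measure]_(x in `[a, b]) (`|x - a| `^ p)%:E =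
   ((b - a) `^ (p + 1) / (p + 1))%:E)%E.
Proof.
move=> p0 ab; have p1 : 0 < p + 1 by rewrite addr_gt0.
have cont q q0 := @continuous_dist_powR R a q q0.
pose F x := (x - a) `^ (p + 1) / (p + 1).
have dF x : a < x -> is_derive x 1 F (`|x - a| `^ p).
  move=> ax; have xa : 0 < x - a by rewrite subr_gt0.
  rewrite gtr0_norm//.
  have h : is_derive (x - a) 1 (@powR R ^~ (p + 1)) ((p + 1) * (x - a) `^ (p + 1 - 1)).
    exact: is_derive1_powR.
  have h2 : is_derive x 1 (fun y : R => (y - a) `^ (p + 1)) ((p + 1) * (x - a) `^ p).
    have := @is_derive1_comp _ (@powR R ^~ (p + 1)) (fun y => y - a) x _ _ h _.
    rewrite addrK => /(_ 1); rewrite mulr1; apply.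
    by apply: is_derive_eq; rewrite subr0.
  by apply: is_derive_eq; rewrite scaler0 add0r /= [_ *: _]mulrA mulVf ?mul1r// gt_eqF.
(* [F] is controlled only to the right of [a]; there it agrees with the continuous function that has
   |x - a| in place of x - a, which gives the one-sided limit. *)
have cF : F @ a^'+ --> F a.
  apply: (@cvg_trans _ ((fun x => `|x - a| `^ (p + 1) / (p + 1)) @ a^'+)).
    apply: near_eq_cvg; near=> x; rewrite /F ger0_norm// subr_ge0.
    by near: x; exact: nbhs_right_ge.
  apply: cvg_at_right_filter; rewrite /F -[X in X `^ _]ger0_norm ?subrr//.
  by apply: cvgMl; have := cont _ p1 a; rewrite /continuous_at subrr.
rewrite (@continuous_FTC2 _ _ F)//.
- by rewrite /F subrr powR0 ?gt_eqF// mul0r sube0.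
- by apply: continuous_subspaceT; exact: cont.
- split.
  + by move=> x /[!in_itv]/= /andP[ax _]; case: (dF x ax).
  + exact: cF.
  + apply: cvg_at_left_filter; apply: differentiable_continuous.
    by apply/derivable1_diffP; case: (dF b ab).
- by move=> x /[!in_itv]/= /andP[ax _]; rewrite derive1E; case: (dF x ax).
Unshelve. all: end_near. Qed.

(** The reflection x -> -x carries this to the case of an interval to the right of the anchor. *)
Lemma integral_dist_powR_left (R : realType) (p a b : R) : 0 < p -> b < a ->
  (\int[lebesgue_measure]_(x in `[b, a]) (`|x - a| `^ p)%:E =
   ((a - b) `^ (p + 1) / (p + 1))%:E)%E.
Proof.
move=> p0 ba; rewrite -[X in `[X, _]]opprK -[X in `[_, X]]opprK.
rewrite integration_by_substitution_oppr ?lerN2 ?ltW//; last first.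
  by apply: continuous_subspaceT; exact: continuous_dist_powR.
under eq_integral do rewrite /= -opprD normrN -[in X in _ + X](opprK a).
by rewrite integral_dist_powR_right ?ltrN2// opprK addrC.
Qed.

(** * Factorization of integrals of products over coordinates *)

Lemma measurable_tuple_prod (R : realType) n (g : 'I_n -> R -> R) :
  (forall i, measurable_fun setT (g i)) ->
  measurable_fun setT (fun t : n.-tuple R => \prod_(i < n) g i (tnth t i)).
Proof.
move=> mg; apply: measurable_prod => i _.
apply: (measurableT_comp (mg i)); exact: measurable_tnth.
Qed.

(** Induction on [n]: the measure on tuples of length [n.+1] is the image of a product measure under
    cons, so Tonelli splits off the first coordinate. *)
Lemma integral_lebesgue_tuple_prod (R : realType) n (g : 'I_n -> R -> R) :
  (forall i, measurable_fun setT (g i)) -> (forall i x, 0 <= g i x) ->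
  (\int[lebesgue_tuple R n]_t (\prod_(i < n) g i (tnth t i))%:E =
   \prod_(i < n) \int[lebesgue_measure]_x (g i x)%:E)%E.
Proof.
elim: n g => [|n IH] g mg g0.
  rewrite big_ord0 /= integral_dirac//; last first.
    by apply/measurable_EFinP; exact: measurable_tuple_prod.
  by rewrite diracT big_ord0 mule1.
have mG := measurable_tuple_prod mg.
have mG' := measurable_tuple_prod (fun i => mg (lift ord0 i)).
have G0 t : 0 <= \prod_(i < n) g (lift ord0 i) (tnth t i) by exact: prodr_ge0.
rewrite /= ge0_integral_pushforward//; last 3 first.
- exact: measurable_uncurry_cons.
- exact/measurable_EFinP.
- by move=> t _; rewrite lee_fin prodr_ge0.
rewrite preimage_setT fubini_tonelli1//; last 2 first.
- by apply/measurable_EFinP; apply: (measurableT_comp mG);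
    exact: measurable_uncurry_cons.
- by move=> t /=; rewrite lee_fin prodr_ge0.
rewrite big_ord_recl -IH//.
rewrite /fubini_F -ge0_integralZr//; last 3 first.
- by have := mg ord0 => ?; exact/measurable_EFinP.
- by move=> x _; rewrite lee_fin.
- by apply: integral_ge0 => t _; rewrite lee_fin.
apply: eq_integral => x _; rewrite -ge0_integralZl//; last 3 first.
- exact/measurable_EFinP.
- by move=> t _; rewrite lee_fin.
- by rewrite lee_fin.
apply: eq_integral => t _; rewrite /= big_ord_recl EFinM; congr (_ * _%:E)%E.
by apply: eq_bigr => i _; rewrite tnthS.
Qed.

(** The box is absorbed into the integrand: the product of the restricted factors vanishes as soon
    as one coordinate leaves its side. *)
Lemma integral_lebesgue_tuple_box (R : realType) n (A : 'I_n -> set R)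
    (f : R -> R) :
  (forall i, measurable (A i)) -> measurable_fun setT f -> (forall x, 0 <= f x) ->
  (\int[lebesgue_tuple R n]_(t in [set t | forall i, A i (tnth t i)])
      (\prod_(i < n) f (tnth t i))%:E =
   \prod_(i < n) \int[lebesgue_measure]_(x in A i) (f x)%:E)%E.
Proof.
move=> mA mf f0; rewrite integral_mkcond.
transitivity (\int[lebesgue_tuple R n]_t
    (\prod_(i < n) (f \_ (A i)) (tnth t i))%:E)%E.
  apply: eq_integral => t _; rewrite patchE; case: ifPn.
    rewrite inE /= => At; congr (_%:E); apply: eq_bigr => i _.
    by rewrite patchE mem_set.
  rewrite notin_setE /= => /existsNP[i nAi].
  by rewrite (bigD1 i)//= patchE memNset// mul0r.
rewrite (@integral_lebesgue_tuple_prod _ _ (fun i => f \_ (A i))).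
- by apply: eq_bigr => i _; rewrite [RHS]integral_mkcond restrict_EFin.
- by move=> i; apply/(measurable_restrictT _ _).1 => //; exact: measurable_funTS.
- by move=> i x; rewrite patchE; case: ifP.
Qed.

Lemma powR_prod (R : realType) (I : Type) (s : seq I) (f : I -> R) (p : R) :
  (forall i, 0 <= f i) -> (\prod_(i <- s) f i) `^ p = \prod_(i <- s) f i `^ p.
Proof.
move=> f0; elim: s => [|i s IH]; first by rewrite !big_nil powR1.
by rewrite !big_cons powRM ?IH// prodr_ge0.
Qed.

Lemma measurable_tuple_box (R : realType) n (A : 'I_n -> set R) :
  (forall i, measurable (A i)) ->
  measurable [set t : n.-tuple R | forall i, A i (tnth t i)].
Proof.
move=> mA; rewrite (_ : [set t | _] =
    \bigcap_(i in [set: 'I_n]) (@tnth n R ^~ i @^-1` A i)).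
  apply: fin_bigcap_measurable => // i _.
  by rewrite -[X in measurable X]setTI; exact: measurable_tnth.
by apply/seteqP; split => t /= h i => [_|]; exact: h.
Qed.

(** * Volume of the test boxes and measurability of the discrepancy function *)

Lemma vol_anchored_box (R : realType) (a : R) d (t : d.-tuple R) :
  vol (anchored_box a t) = \prod_(i < d) `|tnth t i - a|.
Proof.
rewrite /vol (_ : anchored_box a t = [set y | forall i,
    (`[Num.min (tnth t i) a, Num.max (tnth t i) a[%classic : set R) (tnth y i)]); last first.
  by apply/seteqP; split => y /= h i; have := h i; rewrite in_itv.
rewrite (@lebesgue_tuple_box _ _
  (fun i => `[Num.min (tnth t i) a, Num.max (tnth t i) a[%classic))//.
rewrite (eq_bigr (fun i => `|tnth t i - a|%:E)); last first.
  move=> i _; rewrite lebesgue_measure_itv/= lte_fin.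
  have [h|h|->] := ltgtP (tnth t i) a.
  - by rewrite h ltr0_norm ?subr_lt0// opprB EFinB.
  - by rewrite h gtr0_norm ?subr_gt0// EFinB.
  - by rewrite ltxx subrr normr0.
by rewrite prodEFin.
Qed.

(** This product form makes the integrals over the cube and over each orthant split into
    one-dimensional ones. *)
Lemma vol_anchored_box_powR (R : realType) (a p : R) d (t : d.-tuple R) :
  vol (anchored_box a t) `^ p = \prod_(i < d) `|tnth t i - a| `^ p.
Proof. by rewrite vol_anchored_box powR_prod. Qed.

Lemma measurable_disc_fun (R : realType) (a : R) d (P : {fset d.-tuple R}) :
  measurable_fun setT (disc_fun a P).
Proof.
apply: measurable_funB; last first.
  under eq_fun do rewrite vol_anchored_box.
  apply: (@measurable_tuple_prod _ _ (fun=> fun x => `|x - a|)) => i.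
  by apply: measurableT_comp => //; exact: measurable_funB.
apply: measurable_funM => //; apply: measurable_sum => y.
(* For fixed [y], the parameters x whose interval J(x) contains y_i form a ray: x > y_i if a <= y_i,
   and x <= y_i otherwise. *)
pose A (i : 'I_d) : set R :=
  [set x | Num.min x a <= tnth y i < Num.max x a].
have mA i : measurable (A i).
  rewrite (_ : A i = if a <= tnth y i then `]tnth y i, +oo[%classic
                     else `]-oo, tnth y i]%classic); first by case: ifP.
  apply/seteqP; case: leP => ay; split => x /=;
    rewrite /A/= in_itv/= ?andbT ge_min lt_max.
  - by case/andP => _ /orP[//|/lt_le_trans/(_ ay)]; rewrite ltxx.
  - by move=> ->; rewrite ay orbT.
  - by case/andP => /orP[//|/le_lt_trans/(_ ay)]; rewrite ltxx.
  - by move=> ->; rewrite ay orbT.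
rewrite (_ : (fun t => _) = \1_[set t : d.-tuple R | forall i, A i (tnth t i)]).
  by apply: measurable_indic; exact: measurable_tuple_box.
by apply/funext => t; rewrite !indicE; congr (nat_of_bool _)%:R;
  apply/idP/idP; rewrite !inE.
Qed.

(** * Boxes cut out by the anchor, and the pointwise bound *)

Definition side (R : realType) (a y : R) : set R :=
  if y < a then `[0, a[%classic else `[a, 1]%classic.

(** Among the 2^d boxes into which [a] cuts the cube, the one containing [y] when [y] lies in the
    cube. Indexing by points allows sums over [P] directly. *)
Definition orthant (R : realType) (a : R) d (y : d.-tuple R) : set (d.-tuple R) :=
  [set t | forall i, side a (tnth y i) (tnth t i)].

Lemma measurable_orthant (R : realType) (a : R) d (y : d.-tuple R) :
  measurable (orthant a y).
Proof.
apply: (@measurable_tuple_box _ _ (fun i => side a (tnth y i))) => i.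
by rewrite /side; case: ifP.
Qed.

Lemma orthant_subset_cube (R : realType) (a : R) d (y : d.-tuple R) :
  0 < a < 1 -> orthant a y `<=` closed_cube (d := d).
Proof.
move=> /andP[a0 a1] t ty i; have := ty i; rewrite /side; case: ifP => _ /=;
  rewrite in_itv/= => /andP[h1 h2]; apply/andP; split; lra.
Qed.

(** If y_i < a, the lower bound of J(t_i) can only be met with t_i <= y_i < a; if y_i >= a, the
    upper bound can only be met with t_i > y_i >= a. *)
Lemma anchored_box_orthant (R : realType) (a : R) d (t y : d.-tuple R) :
  closed_cube t -> anchored_box a t y -> orthant a y t.
Proof.
move=> ct ty i; have := ty i; have /andP[t0 t1] := ct i.
rewrite ge_min lt_max /side; case: (ltP _ a) => ya /=; rewrite in_itv/= ?t0 ?t1 ?andbT.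
  by rewrite ?orbF ?orbT ?andbT => /le_lt_trans; exact.
by rewrite ?orbF ?orbT ?andbT /= => yt; exact: le_trans ya (ltW yt).
Qed.

(** If [t] is in the orthant of a point of [P], one summand already equals the left-hand side;
    several points sharing an orthant only enlarge the sum. *)
Lemma vol_le_disc_fun (R : realType) (a p : R) d (P : {fset d.-tuple R})
    (t : d.-tuple R) : closed_cube t ->
  ((vol (anchored_box a t) `^ p)%:E <= (`|disc_fun a P t| `^ p)%:E +
   \sum_(y <- P) ((fun t => (vol (anchored_box a t) `^ p)%:E) \_ (orthant a y)) t)%E.
Proof.
move=> ct.
have v0 y : (0 <= ((fun t => (vol (anchored_box a t) `^ p)%:E) \_ (orthant a y)) t)%E.
  by rewrite patchE; case: ifP => // _; rewrite lee_fin powR_ge0.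
have [[y yP ty]|h] := pselect (exists2 y, y \in P & orthant a y t).
  rewrite (big_fsetD1 y)//= {1}patchE mem_set//.
  by rewrite addeCA leeDl// adde_ge0 ?lee_fin ?powR_ge0 ?sume_ge0.
(* Here [t] is in the orthant of no point of [P], so the counting sum is 0; this covers empty [P],
   where the prefactor is 0^-1. *)
rewrite (_ : disc_fun a P t = - vol (anchored_box a t)).
  rewrite normrN ger0_norm ?leeDl ?sume_ge0//.
  by rewrite vol_anchored_box prodr_ge0.
rewrite /disc_fun big_seq big1 ?mulr0 ?sub0r// => y yP.
rewrite indicE memNset// => /(anchored_box_orthant ct) ty.
by apply: h; exists y.
Qed.

(** * Integrals of the volume over the cube and over the orthants *)

Section moments.
Variables (R : realType) (a p : R).
Hypotheses (a01 : 0 < a < 1) (p1 : 1 <= p).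

Let a0 : 0 < a. Proof. by case/andP: a01. Qed.
Let a1 : a < 1. Proof. by case/andP: a01. Qed.
Let p0 : 0 < p. Proof. exact: lt_le_trans p1. Qed.
Let pS0 : 0 < p + 1. Proof. by rewrite addr_gt0. Qed.
Let b0 : 0 < 1 - a. Proof. by rewrite subr_gt0. Qed.
Let m := Num.max a (1 - a).
Let m0 : 0 < m. Proof. by rewrite lt_max a0. Qed.

(** The integral of |x - a|^p over the unit interval; [side_bound] is the larger of the
    contributions from the two sides of [a]. *)
Let moment : R := (a `^ (p + 1) + (1 - a) `^ (p + 1)) / (p + 1).
Let side_bound : R := m `^ (p + 1) / (p + 1).

Let side_bound_gt0 : 0 < side_bound.
Proof. by rewrite divr_gt0 ?powR_gt0. Qed.

(** Since (1/m - 1) m = 1 - m is the smaller of a and 1 - a, expanding the product yields both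
    powers in [moment]. *)
Lemma Cp1_side_bound : Cp1 a p * side_bound = moment.
Proof.
rewrite /Cp1 -/m mulrA; congr (_ / _).
rewrite mulrDl mul1r -powRM ?subr_ge0//; last 2 first.
- by rewrite invf_ge1// ge_max !ltW// ltrBlDr ltrDl.
- exact: ltW.
rewrite mulrBl mulVf ?gt_eqF// mul1r /m.
case: leP => _ //; rewrite addrC; congr (_ `^ _ + _); lra.
Qed.

Lemma Cp1_gt1 : 1 < Cp1 a p.
Proof.
rewrite /Cp1 ltrDl powR_gt0// subr_gt0 invf_gt1 -/m//.
by rewrite gt_max a1 ltrBlDr ltrDl.
Qed.

Let mdist : measurable_fun setT (fun x : R => `|x - a| `^ p).
Proof. by apply: continuous_measurable_fun; exact: continuous_dist_powR. Qed.

Lemma integral_side y :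
  (\int[lebesgue_measure]_(x in side a y) (`|x - a| `^ p)%:E =
   ((if y < a then a else 1 - a) `^ (p + 1) / (p + 1))%:E)%E.
Proof.
rewrite /side; case: ifP => _; last by rewrite integral_dist_powR_right.
rewrite integral_itv_bndo_bndc; last first.
  by apply/measurable_EFinP; exact: measurable_funTS.
by rewrite integral_dist_powR_left// subr0.
Qed.

Lemma integral_unit_interval :
  (\int[lebesgue_measure]_(x in `[0%R, 1%R]) (`|x - a| `^ p)%:E = moment%:E)%E.
Proof.
rewrite (@itv_bndbnd_setU _ _ _ (BLeft a)) ?bnd_simp ?ltW//.
rewrite ge0_integral_setU//; last 2 first.
- by apply/measurable_EFinP; exact: measurable_funTS.
- apply/disj_setPS => x [] /=; rewrite !in_itv/= => /andP[_ xa] /andP[].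
  by rewrite leNgt xa.
(* The points 0 and 1 serve as representatives of the left and the right side. *)
have := integral_side 0; rewrite /side a0 => ->.
have := integral_side 1; rewrite /side ltNge ltW// => ->.
by rewrite -EFinD -mulrDl.
Qed.

Lemma integral_vol_cube d :
  (\int[lebesgue_tuple R d]_(t in closed_cube (d := d))
     (vol (anchored_box a t) `^ p)%:E = (moment ^+ d)%:E)%E.
Proof.
under eq_integral do rewrite vol_anchored_box_powR.
rewrite (_ : closed_cube (d := d) =
    [set t | forall i, (fun=> `[0, 1]%classic : set R) i (tnth t i)]); last first.
  by apply/seteqP; split => t /= h i; have := h i; rewrite in_itv.
rewrite (@integral_lebesgue_tuple_box _ _ (fun=> `[0, 1]%classic)
  (fun x => `|x - a| `^ p))//.
by rewrite integral_unit_interval prodEFin prodr_const card_ord.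
Qed.

Lemma integral_vol_orthant d (y : d.-tuple R) :
  (\int[lebesgue_tuple R d]_(t in orthant a y)
     (vol (anchored_box a t) `^ p)%:E <= (side_bound ^+ d)%:E)%E.
Proof.
under eq_integral do rewrite vol_anchored_box_powR.
rewrite (@integral_lebesgue_tuple_box _ _ (fun i => side a (tnth y i))
  (fun x => `|x - a| `^ p))//; last by move=> i; rewrite /side; case: ifP.
under eq_bigr do rewrite integral_side.
rewrite prodEFin lee_fin -[X in _ ^+ X]card_ord -prodr_const.
apply: ler_prod => i _; rewrite divr_ge0 ?powR_ge0 ?(ltW pS0)//=.
rewrite ler_pM2r ?invr_gt0//.
apply: ge0_ler_powR; rewrite ?nnegrE ?(ltW pS0) ?(ltW m0)//.
  by case: ifP => _; exact: ltW.
by case: ifP => _; rewrite le_max lexx ?orbT.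
Qed.

Lemma moment_le_disc d (P : {fset d.-tuple R}) :
  ((moment ^+ d)%:E <=
   \int[lebesgue_tuple R d]_(t in closed_cube (d := d)) (`|disc_fun a P t| `^ p)%:E +
   (#|` P|%:R * side_bound ^+ d)%:E)%E.
Proof.
have mcube : measurable (closed_cube (d := d) : set (d.-tuple R)).
  rewrite (_ : closed_cube (d := d) =
    [set t | forall i, (fun=> `[0, 1]%classic : set R) i (tnth t i)]).
    exact: (@measurable_tuple_box _ _ (fun=> `[0, 1]%classic)).
  by apply/seteqP; split => t /= h i; have := h i; rewrite in_itv.
have mvol D : measurable_fun D (fun t : d.-tuple R => (vol (anchored_box a t) `^ p)%:E).
  apply: measurable_funTS; apply/measurable_EFinP.
  under eq_fun do rewrite vol_anchored_box_powR.
  exact: (@measurable_tuple_prod _ _ (fun=> fun x => `|x - a| `^ p)).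
have mres y : measurable_fun (closed_cube (d := d))
    ((fun t => (vol (anchored_box a t) `^ p)%:E) \_ (orthant a y)).
  apply: measurable_funTS; apply/(measurable_restrictT _ _).1 => //.
  exact: measurable_orthant.
have res0 y t : (0 <= ((fun t => (vol (anchored_box a t) `^ p)%:E) \_ (orthant a y)) t)%E.
  by rewrite patchE; case: ifP => // _; rewrite lee_fin powR_ge0.
have mdisc : measurable_fun (closed_cube (d := d))
    (fun t => (`|disc_fun a P t| `^ p)%:E).
  apply: measurable_funTS; apply/measurable_EFinP.
  apply: (measurableT_comp (measurable_powR p)).
  by apply: measurableT_comp => //; exact: measurable_disc_fun.
rewrite -integral_vol_cube.
apply: (@le_trans _ _ (\int[lebesgue_tuple R d]_(t in closed_cube (d := d))
    ((`|disc_fun a P t| `^ p)%:E + \sum_(y <- P)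
     ((fun t => (vol (anchored_box a t) `^ p)%:E) \_ (orthant a y)) t))%E).
  apply: ge0_le_integral => //.
  - by move=> t _; rewrite lee_fin powR_ge0.
  - exact: mvol.
  - by apply: emeasurable_funD => //; exact: emeasurable_sum.
  - exact: vol_le_disc_fun.
rewrite ge0_integralD//; last 2 first.
- by move=> t _; rewrite sume_ge0.
- exact: emeasurable_sum.
rewrite leeD2l// ge0_integral_sum//.
apply: (@le_trans _ _ (\sum_(y <- P) (side_bound ^+ d)%:E)%E).
  (* Restricting the integrand to an orthant means integrating over its intersection with the cube,
     which is the orthant itself. *)
  apply: lee_sum => y _; rewrite -integral_mkcondr.
  rewrite setIidr; first exact: integral_vol_orthant.
  exact: orthant_subset_cube.
by rewrite sumEFin lee_fin big_const_seq count_predT iter_addr_0 cardfE mulr_natl.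
Qed.

(** * From small discrepancy to many points *)

Lemma card_ge_of_disc_le eps d (P : {fset d.-tuple R}) : 0 < eps < 1 ->
  (Lp_disc a p P <= eps%:E * Lp_disc_init a p d)%E ->
  Cp1 a p ^+ d * (1 - eps) <= #|` P|%:R.
Proof.
move=> /andP[e0 e1]; rewrite /Lp_disc /Lp_disc_init integral_vol_cube.
set E := (\int[_]_(_ in _) _)%E => EI.
have E0 : (0 <= E)%E by apply: integral_ge0 => t _; rewrite lee_fin powR_ge0.
have I0 : 0 <= moment ^+ d.
  by rewrite exprn_ge0// divr_ge0 ?addr_ge0 ?powR_ge0// ltW.
have Ele : (E <= (eps * moment ^+ d)%:E)%E.
  (* Raising to the power [p] removes both roots and leaves the factor eps^p, which is at most [eps]
     because eps < 1 <= p. *)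
  have : ((E `^ p^-1) `^ p <= (eps%:E * (moment ^+ d)%:E `^ p^-1) `^ p)%E.
    apply: gt0_ler_poweR => //; rewrite ?in_itv/= ?leey ?andbT.
    - exact: ltW.
    - exact: poweR_ge0.
    - by rewrite lee_fin mulr_ge0 ?powR_ge0// ltW.
  rewrite poweRM ?lee_fin ?poweR_ge0 ?(ltW e0) ?powR_ge0//.
  rewrite -!poweRrM mulVf ?gt_eqF//.
  rewrite !poweRe1// => /le_trans; apply.
  rewrite -EFinM lee_fin ler_wpM2r//.
  by rewrite -[leRHS]powRr1 ?(ltW e0)// ger_powR// e0 ltW.
have := moment_le_disc P; rewrite -/E => /le_trans/(_ (leeD2r _ Ele)).
rewrite -EFinD lee_fin -lerBlDl -{1}[moment ^+ d]mul1r -mulrBl.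
rewrite -Cp1_side_bound exprMn mulrA ler_pM2r ?exprn_gt0//.
by rewrite mulrC.
Qed.

(** A finite minimum is attained by some point set, to which the cardinality bound applies;
    otherwise the value is +oo. *)
Lemma Nmin_ge eps d : 0 < eps < 1 ->
  ((Cp1 a p ^+ d * (1 - eps))%:E <= Nmin a p eps d)%E.
Proof.
move=> e01; rewrite /Nmin /min_nat; case: pselect => [exS|_]; last exact: leey.
case: ex_minnP => N /[!inE]/= -[_ [P [_ <- PN]]] _.
by rewrite lee_fin card_ge_of_disc_le.
Qed.

End moments.

Theorem corollary2 (R : realType) (a p : R) (ha : 0 < a < 1) (hp : 1 <= p) :
  [/\ curse_of_dimensionality (Nmin a p),
      (forall (eps : R) (d : nat), 0 < eps < 1 -> (0 < d)%N ->
         ((Cp1 a p ^+ d * (1 - eps))%:E <= Nmin a p eps d)%E)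
    & 1 < Cp1 a p].
Proof.
have C1 := Cp1_gt1 p ha.
split => // [|eps d e01 _]; last exact: (Nmin_ge ha hp d e01).
(* For eps <= 1/2 the factor 1 - eps is at least 1/2, which serves as [c]; [tau] is chosen so that 1
   + tau is [Cp1 a p]. *)
exists 2^-1, (Cp1 a p - 1), 2^-1; split; rewrite ?subr_gt0 ?invr_gt0//.
move=> eps d /andP[e0 e2] _.
apply: le_trans (Nmin_ge ha hp d _); last by lra.
rewrite addrC subrK lee_fin mulrC ler_wpM2l; first by [].
  by rewrite exprn_ge0// ltW// (lt_trans _ C1).
lra.
Qed.
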